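(* Let $0\to V\to\widehat{\mathfrak g}\xrightarrow{p}\mathfrak g\to 0$ be an abelian extension of Leibniz 2-algebras (with a splitting $\sigma=(\sigma_0,\sigma_1)$), and let $(\beta,\alpha)\in\mathrm{Aut}(V)\times\mathrm{Aut}(\mathfrak g)$, $\beta=(\beta_0,\beta_1)$, $\alpha=(\alpha_0,\alpha_1,\alpha_2)$. Then the pair $(\beta,\alpha)$ is inducible if and only if there exists a linear map $\lambda=(\lambda_0,\lambda_1,\lambda_2)\in\mathrm{Hom}(\mathfrak g,V)$, that is, linear maps $\lambda_0:\mathfrak g_0\to V_0$, $\lambda_1:\mathfrak g_1\to V_1$, $\lambda_2:\mathfrak g_0\otimes\mathfrak g_0\to V_1$, such that for all $x,y,z\in\mathfrak g_0$, $a\in\mathfrak g_1$, $v,w\in V_0$, $m\in V_1$: \begin{align*} &\beta_0(\psi(a))-\psi(\alpha_1(a))=\mathrm d_V(\lambda_1(a))-\lambda_0(\mathrm d_{\mathfrak g}(a)),\\ &\beta_0(\omega(x,y))-\omega(\alpha_0(x),\alpha_0(y))=l_0(\alpha_0(x))(\lambda_0(y))+r_0(\alpha_0(y))(\lambda_0(x))-\lambda_0([x,y])+\mathrm d_V\lambda_2(x,y)+\psi(\alpha_2(x,y)),\\ &\beta_1(\mu(x,a))-\mu(\alpha_0(x),\alpha_1(a))=l_0(\alpha_0(x))(\lambda_1(a))+r_1(\alpha_1(a))(\lambda_0(x))-\lambda_1([x,a])+\lambda_2(x,\mathrm d_{\mathfrak g}(a)),\\ &\beta_1(\nu(a,x))-\nu(\alpha_1(a),\alpha_0(x))=r_0(\alpha_0(x))(\lambda_1(a))+l_1(\alpha_1(a))(\lambda_0(x))-\lambda_1([a,x])+\lambda_2(\mathrm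 d_{\mathfrak g}(a),x),\\ &\beta_1\theta(x,y,z)-\theta(\alpha_0(x),\alpha_0(y),\alpha_0(z))-\mu(\alpha_0(x),\alpha_2(y,z))+\nu(\alpha_2(x,y),\alpha_0(z))+r_1(\alpha_2(x,z))(\lambda_0(y))+\mu(\alpha_0(y),\alpha_2(x,z))\\ &\quad=-l_2(\alpha_0(x),\alpha_0(y))(\lambda_0(z))-m_2(\alpha_0(x),\alpha_0(z))(\lambda_0(y))-\lambda_1(l_3^{\mathfrak g}(x,y,z))-r_2(\alpha_0(y),\alpha_0(z))(\lambda_0(x))\\ &\qquad+\lambda_2(x,[y,z])-\lambda_2([x,y],z)-\lambda_2(y,[x,z])+l_0(\alpha_0(x))(\lambda_2(y,z))+r_1(\alpha_2(y,z))(\lambda_0(x))\\ &\qquad-r_0(\alpha_0(z))(\lambda_2(x,y))-l_1(\alpha_2(x,y))(\lambda_0(z))-l_0(\alpha_0(y))(\lambda_2(x,z)),\\ &\beta_0l_0(x)\beta_0^{-1}(v)=l_0(\alpha_0(x))(v),\qquad \beta_0r_0(x)\beta_0^{-1}(v)=r_0(\alpha_0(x))(v),\\ &\beta_1l_0(x)\beta_1^{-1}(m)=l_0(\alpha_0(x))(m),\qquad \beta_1r_0(x)\beta_1^{-1}(m)=r_0(\alpha_0(x))(m),\\ &\beta_1r_1(a)\beta_0^{-1}(v)=r_1(\alpha_1(a))(v),\qquad \beta_1l_1(a)\beta_0^{-1}(v)=l_1(\alpha_1(a))(v),\\ &l_2(\alpha_0(x),\alpha_0(y))(w)+l_1(\alpha_2(x,y))(w)=\beta_1l_2(x,y)\beta_0^{-1}(w),\\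 &r_2(\alpha_0(x),\alpha_0(y))(w)-r_1(\alpha_2(x,y))(w)=\beta_1r_2(x,y)\beta_0^{-1}(w),\\ &m_2(\alpha_0(x),\alpha_0(y))(w)+r_1(\alpha_2(x,y))(w)=\beta_1m_2(x,y)\beta_0^{-1}(w). \end{align*}
   Context: All vector spaces are over a fixed field. A Leibniz 2-algebra $\mathfrak g=\mathfrak g_1\oplus\mathfrak g_0$ consists of a linear map $\mathrm d:\mathfrak g_1\to\mathfrak g_0$, bilinear brackets $[\cdot,\cdot]:\mathfrak g_i\times\mathfrak g_j\to\mathfrak g_{i+j}$ ($0\le i+j\le 1$) and a trilinear map $l_3:\mathfrak g_0\times\mathfrak g_0\times\mathfrak g_0\to\mathfrak g_1$ such that for $x,y,z,t\in\mathfrak g_0$, $a,b\in\mathfrak g_1$: $\mathrm d[x,a]=[x,\mathrm da]$; $\mathrm d[a,x]=[\mathrm da,x]$; $[\mathrm da,b]=[a,\mathrm db]$; $\mathrm dl_3(x,y,z)=[x,[y,z]]-[[x,y],z]-[y,[x,z]]$; $l_3(x,y,\mathrm da)=[x,[y,a]]-[[x,y],a]-[y,[x,a]]$; $l_3(x,\mathrm da,y)=[x,[a,y]]-[[x,a],y]-[a,[x,y]]$; $l_3(\mathrm da,x,y)=[a,[x,y]]-[[a,x],y]-[x,[a,y]]$; and $[x,l_3(y,z,t)]-[y,l_3(x,z,t)]+[z,l_3(x,y,t)]+[l_3(x,y,z),t]-l_3([x,y],z,t)-l_3(y,[x,z],t)-l_3(y,z,[x,t])+l_3(x,[y,z],t)+l_3(x,z,[y,t])-l_3(x,y,[z,t])=0$.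 A homomorphism $F=(F_0,F_1,F_2):\mathfrak g\to\mathfrak g'$ consists of linear maps $F_0:\mathfrak g_0\to\mathfrak g_0'$, $F_1:\mathfrak g_1\to\mathfrak g_1'$ and a bilinear map $F_2:\mathfrak g_0\times\mathfrak g_0\to\mathfrak g_1'$ with $F_0\mathrm d=\mathrm d'F_1$; $F_0[x,y]-[F_0x,F_0y]'=\mathrm d'F_2(x,y)$; $F_1[x,a]-[F_0x,F_1a]'=F_2(x,\mathrm da)$; $F_1[a,x]-[F_1a,F_0x]'=F_2(\mathrm da,x)$; $F_1l_3(x,y,z)-l_3'(F_0x,F_0y,F_0z)=F_2(x,[y,z])-F_2([x,y],z)-F_2(y,[x,z])+[F_0x,F_2(y,z)]'-[F_2(x,y),F_0z]'-[F_0y,F_2(x,z)]'$. It is strict if $F_2=0$; an automorphism is a homomorphism $\mathfrak g\to\mathfrak g$ with $F_0,F_1$ bijective. An extension of $\mathfrak g$ by $V$ is a short exact sequence $0\to V\xrightarrow{i}\widehat{\mathfrak g}\xrightarrow{p}\mathfrak g\to0$ of Leibniz 2-algebras with $i,p$ strict, exact in each degree; $i$ is regarded as an inclusion. It is abelian if $V$ is abelian, i.e. all brackets on $V$ and $l_3^V$ vanish (so $V$ is a 2-term complex $\mathrm d_V:V_1\to V_0$). A splitting $\sigma$ is a pair of linear maps $\sigma_i:\mathfrak g_i\to\widehat{\mathfrak g}_i$ with $p_i\sigma_i=\mathrm{id}$. The induced representation $\rho=(l_0,r_0,l_1,r_1,l_2,m_2,r_2)$ of $\mathfrak g$ on $V$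 is, for $x,y\in\mathfrak g_0$, $a\in\mathfrak g_1$, $u\in V_0$, $m\in V_1$: $l_0(x)(u+m)=[\sigma_0x,u+m]$, $r_0(x)(u+m)=[u+m,\sigma_0x]$, $l_1(a)(u)=[\sigma_1a,u]$, $r_1(a)(u)=[u,\sigma_1a]$, $l_2(x,y)(u)=-\widehat l_3(\sigma_0x,\sigma_0y,u)$, $m_2(x,y)(u)=-\widehat l_3(\sigma_0x,u,\sigma_0y)$, $r_2(x,y)(u)=-\widehat l_3(u,\sigma_0x,\sigma_0y)$ (operations in $\widehat{\mathfrak g}$). The associated 2-cocycle $(\psi,\omega,\mu,\nu,\theta)$ is: $\psi(a)=\widehat{\mathrm d}\sigma_1(a)-\sigma_0(\mathrm d_{\mathfrak g}a)$, $\omega(x,y)=[\sigma_0x,\sigma_0y]-\sigma_0[x,y]$, $\mu(x,a)=[\sigma_0x,\sigma_1a]-\sigma_1[x,a]$, $\nu(a,x)=[\sigma_1a,\sigma_0x]-\sigma_1[a,x]$, $\theta(x,y,z)=\widehat l_3(\sigma_0x,\sigma_0y,\sigma_0z)-\sigma_1l_3^{\mathfrak g}(x,y,z)$. $\mathrm{Aut}(V)$, $\mathrm{Aut}(\widehat{\mathfrak g})$, $\mathrm{Aut}(\mathfrak g)$ are the groups of Leibniz 2-algebra automorphisms of $V,\widehat{\mathfrak g},\mathfrak g$; elements of $\mathrm{Aut}(V)$ are written as pairs $\beta=(\beta_0,\beta_1)$ (with 2-component $0$), i.e. linear bijections of $V_0,V_1$ with $\beta_0\mathrm d_V=\mathrm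 d_V\beta_1$. $\mathrm{Aut}_V(\widehat{\mathfrak g})$ is the group of all automorphisms $F=(F_0,F_1,F_2)$ of $\widehat{\mathfrak g}$ which keep $V$ invariant as a set ($F_0(V_0)=V_0$, $F_1(V_1)=V_1$). For such $F$ put $F|_V=(F_0|_{V_0},F_1|_{V_1})$ and $\overline F=(p_0F_0\sigma_0,\;p_1F_1\sigma_1,\;p_1F_2(\sigma_0\cdot,\sigma_0\cdot))$, and $\Phi(F)=(F|_V,\overline F)$, with $\Phi(F_i)$ denoting the pair of $i$-th components. A pair $(\beta,\alpha)\in\mathrm{Aut}(V)\times\mathrm{Aut}(\mathfrak g)$ is called inducible if there is $F\in\mathrm{Aut}_V(\widehat{\mathfrak g})$ with $\Phi(F_0)=(\beta_0,\alpha_0)$, $\Phi(F_1)=(\beta_1,\alpha_1)$, $\Phi(F_2)=(0,\alpha_2)$.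
   Formalization: The abelian extension is also required to have its l_3 vanish whenever two arguments lie in V, and the condition Φ(F_2)=(0,α_2) is read as requiring F_2 to vanish whenever one argument lies in V; without these the equivalence fails. *)

(* Defs.v *)
From HB Require Import structures.
From mathcomp Require Import all_boot all_order all_algebra.
From mathcomp Require Import boolp classical_sets functions.

Set Implicit Arguments.
Unset Strict Implicit.
Unset Printing Implicit Defensive.

Import GRing.Theory.
Local Open Scope ring_scope.
Local Open Scope classical_set_scope.

(* The inverse of an injective map on its range; the value is [0] off the
   range. *)
Definition inverse (K : fieldType) (U W : lmodType K) (f : U -> W) : W -> U :=
  'pinv_(fun=> 0) [set: U] f.

Definition trilinear (K : fieldType) (U W : lmodType K)
    (f : U -> U -> U -> W) : Prop :=
  [/\ forall y z, linear (fun x => f x y z),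
      forall x z, linear (fun y => f x y z) &
      forall x y, linear (fun z => f x y z)].

(* [br00], [br01] and [br10] are the components of the bracket on
   g0 x g0, g0 x g1 and g1 x g0. *)
Record leibniz2 (K : fieldType) := Leibniz2 {
  g0 : lmodType K;
  g1 : lmodType K;
  diff : {linear g1 -> g0};
  br00 : {bilinear g0 -> g0 -> g0};
  br01 : {bilinear g0 -> g1 -> g1};
  br10 : {bilinear g1 -> g0 -> g1};
  l3 : g0 -> g0 -> g0 -> g1;
  l3_trilinear : trilinear l3;
  diff_br01 : forall x a, diff (br01 x a) = br00 x (diff a);
  diff_br10 : forall a x, diff (br10 a x) = br00 (diff a) x;
  br_diff : forall a b, br01 (diff a) b = br10 a (diff b);
  diff_l3 : forall x y z,
    diff (l3 x y z) = br00 x (br00 y z) - br00 (br00 x y) z - br00 y (br00 x z);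
  l3_diff3 : forall x y a,
    l3 x y (diff a) = br01 x (br01 y a) - br01 (br00 x y) a - br01 y (br01 x a);
  l3_diff2 : forall x y a,
    l3 x (diff a) y = br01 x (br10 a y) - br10 (br01 x a) y - br10 a (br00 x y);
  l3_diff1 : forall x y a,
    l3 (diff a) x y = br10 a (br00 x y) - br10 (br10 a x) y - br01 x (br10 a y);
  l3_identity : forall x y z t,
    br01 x (l3 y z t) - br01 y (l3 x z t) + br01 z (l3 x y t)
    + br10 (l3 x y z) t
    - l3 (br00 x y) z t - l3 y (br00 x z) t - l3 y z (br00 x t)
    + l3 x (br00 y z) t + l3 x z (br00 y t) - l3 x y (br00 z t) = 0
}.

Record leibniz2_hom (K : fieldType) (L M : leibniz2 K) := Leibniz2Hom {
  hom0 : {linear g0 L -> g0 M};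
  hom1 : {linear g1 L -> g1 M};
  hom2 : {bilinear g0 L -> g0 L -> g1 M};
  hom_diff : forall a, hom0 (diff L a) = diff M (hom1 a);
  hom_br00 : forall x y,
    hom0 (br00 L x y) - br00 M (hom0 x) (hom0 y) = diff M (hom2 x y);
  hom_br01 : forall x a,
    hom1 (br01 L x a) - br01 M (hom0 x) (hom1 a) = hom2 x (diff L a);
  hom_br10 : forall a x,
    hom1 (br10 L a x) - br10 M (hom1 a) (hom0 x) = hom2 (diff L a) x;
  hom_l3 : forall x y z,
    hom1 (l3 x y z) - l3 (hom0 x) (hom0 y) (hom0 z) =
    hom2 x (br00 L y z) - hom2 (br00 L x y) z - hom2 y (br00 L x z)
    + br01 M (hom0 x) (hom2 y z) - br10 M (hom2 x y) (hom0 z)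
    - br01 M (hom0 y) (hom2 x z)
}.

Definition strict (K : fieldType) (L M : leibniz2 K) (F : leibniz2_hom L M) :=
  forall x y, hom2 F x y = 0.

Definition automorphism (K : fieldType) (L : leibniz2 K)
    (F : leibniz2_hom L L) : Prop :=
  bijective (hom0 F) /\ bijective (hom1 F).

Definition abelian (K : fieldType) (V : leibniz2 K) : Prop :=
  [/\ forall u v, br00 V u v = 0,
      forall u m, br01 V u m = 0,
      forall m u, br10 V m u = 0 &
      forall u v w : g0 V, l3 u v w = 0].

Record extension (K : fieldType) (V g : leibniz2 K) := Extension {
  ghat : leibniz2 K;
  inc : leibniz2_hom V ghat;
  proj : leibniz2_hom ghat g;
  inc_strict : strict inc;
  proj_strict : strict proj;
  inc0_inj : injective (hom0 inc);
  inc1_inj : injective (hom1 inc);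
  exact0 : forall z, hom0 proj z = 0 <-> range (hom0 inc) z;
  exact1 : forall c, hom1 proj c = 0 <-> range (hom1 inc) c;
  proj0_surj : range (hom0 proj) = [set: g0 g];
  proj1_surj : range (hom1 proj) = [set: g1 g]
}.

(* V is abelian as an ideal of the extension: every operation vanishes as soon
   as two of its arguments lie in V.  For the brackets this follows from
   [abelian V], since V x V exhausts the pairs; the ternary operation can have
   a third argument outside V, and then [abelian V] says nothing about it. *)
Definition abelian_extension (K : fieldType) (V g : leibniz2 K)
    (E : extension V g) : Prop :=
  abelian V /\
  forall (u v : g0 V) (z : g0 (ghat E)),
    [/\ l3 (hom0 (inc E) u) (hom0 (inc E) v) z = 0,
        l3 (hom0 (inc E) u) z (hom0 (inc E) v) = 0 &
        l3 z (hom0 (inc E) u) (hom0 (inc E) v) = 0].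

Record splitting (K : fieldType) (V g : leibniz2 K) (E : extension V g) :=
  Splitting {
    split0 : {linear g0 g -> g0 (ghat E)};
    split1 : {linear g1 g -> g1 (ghat E)};
    split0K : forall x, hom0 (proj E) (split0 x) = x;
    split1K : forall a, hom1 (proj E) (split1 a) = a
  }.

Section InducedData.
Variables (K : fieldType) (V g : leibniz2 K) (E : extension V g).
Variable s : splitting E.

Local Notation h := (ghat E).
Local Notation i0 := (hom0 (inc E)).
Local Notation i1 := (hom1 (inc E)).
Local Notation p0 := (hom0 (proj E)).
Local Notation p1 := (hom1 (proj E)).
Local Notation s0 := (split0 s).
Local Notation s1 := (split1 s).

(* The operations of the extension, on the arguments used below, take values in
   the image of V; [inV0] and [inV1] read these values in V. *)
Definition inV0 : g0 h -> g0 V := inverse i0.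
Definition inV1 : g1 h -> g1 V := inverse i1.

(* The operators l_0(x) and r_0(x) act on V0 ([rep_l00], [rep_r00]) and on V1
   ([rep_l01], [rep_r01]). *)
Definition rep_l00 (x : g0 g) (u : g0 V) : g0 V := inV0 (br00 h (s0 x) (i0 u)).
Definition rep_l01 (x : g0 g) (m : g1 V) : g1 V := inV1 (br01 h (s0 x) (i1 m)).
Definition rep_r00 (x : g0 g) (u : g0 V) : g0 V := inV0 (br00 h (i0 u) (s0 x)).
Definition rep_r01 (x : g0 g) (m : g1 V) : g1 V := inV1 (br10 h (i1 m) (s0 x)).
Definition rep_l1 (a : g1 g) (u : g0 V) : g1 V := inV1 (br10 h (s1 a) (i0 u)).
Definition rep_r1 (a : g1 g) (u : g0 V) : g1 V := inV1 (br01 h (i0 u) (s1 a)).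
Definition rep_l2 (x y : g0 g) (u : g0 V) : g1 V :=
  inV1 (- l3 (s0 x) (s0 y) (i0 u)).
Definition rep_m2 (x y : g0 g) (u : g0 V) : g1 V :=
  inV1 (- l3 (s0 x) (i0 u) (s0 y)).
Definition rep_r2 (x y : g0 g) (u : g0 V) : g1 V :=
  inV1 (- l3 (i0 u) (s0 x) (s0 y)).

Definition psi (a : g1 g) : g0 V := inV0 (diff h (s1 a) - s0 (diff g a)).
Definition omega (x y : g0 g) : g0 V :=
  inV0 (br00 h (s0 x) (s0 y) - s0 (br00 g x y)).
Definition mu (x : g0 g) (a : g1 g) : g1 V :=
  inV1 (br01 h (s0 x) (s1 a) - s1 (br01 g x a)).
Definition nu (a : g1 g) (x : g0 g) : g1 V :=
  inV1 (br10 h (s1 a) (s0 x) - s1 (br10 g a x)).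
Definition theta (x y z : g0 g) : g1 V :=
  inV1 (l3 (s0 x) (s0 y) (s0 z) - s1 (l3 x y z)).

Definition preserves_V (F : leibniz2_hom h h) : Prop :=
  hom0 F @` range i0 = range i0 /\ hom1 F @` range i1 = range i1.

(* [Phi0], [Phi1] and [Phi2] express that the components of Phi(F) are
   (beta_0, alpha_0), (beta_1, alpha_1) and (0, alpha_2).  The V-part of F_2 is
   its restriction to the pairs with an argument in V, i.e. to the kernel of
   ghat_0 (x) ghat_0 -> g_0 (x) g_0; its vanishing means that F_2 factors
   through g_0 (x) g_0, as F_2|_V = 0 alone does not. *)
Definition Phi0 (F : leibniz2_hom h h) (b0 : g0 V -> g0 V)
    (a0 : g0 g -> g0 g) : Prop :=
  (forall u, hom0 F (i0 u) = i0 (b0 u)) /\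
  (forall x, p0 (hom0 F (s0 x)) = a0 x).
Definition Phi1 (F : leibniz2_hom h h) (b1 : g1 V -> g1 V)
    (a1 : g1 g -> g1 g) : Prop :=
  (forall m, hom1 F (i1 m) = i1 (b1 m)) /\
  (forall a, p1 (hom1 F (s1 a)) = a1 a).
Definition Phi2 (F : leibniz2_hom h h) (a2 : g0 g -> g0 g -> g1 g) : Prop :=
  (forall u z, hom2 F (i0 u) z = 0 /\ hom2 F z (i0 u) = 0) /\
  (forall x y, p1 (hom2 F (s0 x) (s0 y)) = a2 x y).

Definition inducible (beta : leibniz2_hom V V) (alpha : leibniz2_hom g g) :
    Prop :=
  exists F : leibniz2_hom h h,
    [/\ automorphism F, preserves_V F,
        Phi0 F (hom0 beta) (hom0 alpha),
        Phi1 F (hom1 beta) (hom1 alpha) &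
        Phi2 F (hom2 alpha)].

End InducedData.

(* Main.v *)
From HB Require Import structures.
From mathcomp Require Import boolp classical_sets functions.
Require Import Defs.
From mathcomp Require Import all_boot all_order all_algebra.

Set Implicit Arguments.
Unset Strict Implicit.
Unset Printing Implicit Defensive.

Import GRing.Theory.
Local Open Scope ring_scope.

(* Through the splitting, ghat = s(g) + i(V), and an automorphism F inducing
   (beta, alpha) has the form F_k s = s alpha_k + i lambda_k, F_k i = i beta_k
   (k = 0, 1) and F_2(s, s) = s alpha_2 + i lambda_2, with F_2 zero as soon as
   one argument lies in V.  The homomorphism axioms for F are multilinear
   identities, so it suffices to test them on arguments lying in s(g) or i(V).
   Since alpha is a homomorphism, the s(g)-parts of both sides agree; comparing
   the i(V)-parts, the axioms on arguments all in s(g) are the five cocycle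
   equations, those with exactly one argument in i(V) are the nine equations
   relating beta and alpha to the representation, and those with two or more
   arguments in i(V) hold because the extension is abelian. *)

(* [zmod] decides identities of abelian groups by comparing the integer
   coefficients of the atoms. *)
Inductive zmod_expr :=
  | ZVar of nat | ZZero | ZAdd of zmod_expr & zmod_expr | ZOpp of zmod_expr.

Fixpoint zmod_eval (M : zmodType) (env : seq M) e : M :=
  match e with
  | ZVar i => env`_i
  | ZZero => 0
  | ZAdd e1 e2 => zmod_eval env e1 + zmod_eval env e2
  | ZOpp e1 => - zmod_eval env e1
  end.

Fixpoint zmod_coef (i : nat) e : int :=
  match e with
  | ZVar j => if i == j then 1 else 0
  | ZZero => 0
  | ZAdd e1 e2 => zmod_coef i e1 + zmod_coef i e2
  | ZOpp e1 => - zmod_coef i e1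
  end.

(** A variable beyond [env] causes no harm: the default of [nth] is [0], and such a variable has
    coefficient zero at every index of the sum. *)
Lemma zmod_evalE (M : zmodType) (env : seq M) e :
  zmod_eval env e = \sum_(i < size env) env`_i *~ zmod_coef i e.
Proof.
elim: e => [j||e1 IH1 e2 IH2|e IH] /=.
- case: (ltnP j (size env)) => [lt_j|le_j].
    rewrite (bigD1 (Ordinal lt_j)) //= eqxx big1 ?addr0 // => i ne_ij.
    by rewrite -[X in if X then _ else _]/(i == Ordinal lt_j) (negPf ne_ij).
  rewrite nth_default // big1 // => i _.
  by rewrite (ltn_eqF (leq_trans (ltn_ord i) le_j)).
- by rewrite big1.
- by rewrite IH1 IH2 -big_split; apply: eq_bigr => i _; rewrite mulrzDr.
- by rewrite IH -sumrN; apply: eq_bigr => i _; rewrite mulrNz.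
Qed.

(** The hypothesis mentions [env] only through its length, so it is decided by computation on
    integers while the atoms stay opaque. *)
Lemma zmod_eval_eq (M : zmodType) (env : seq M) e1 e2 :
    all (fun i => zmod_coef i e1 == zmod_coef i e2) (iota 0 (size env)) ->
  zmod_eval env e1 = zmod_eval env e2.
Proof.
move=> /allP eq_e; rewrite !zmod_evalE; apply: eq_bigr => i _.
by rewrite (eqP (eq_e i _)) // mem_iota ltn_ord.
Qed.

Ltac zmod_mem env t :=
  lazymatch env with
  | nil => constr:(false)
  | t :: _ => constr:(true)
  | _ :: ?env' => zmod_mem env' t
  end.

Ltac zmod_vars env t :=
  lazymatch t with
  | ?a + ?b => let env1 := zmod_vars env a in zmod_vars env1 b
  | - ?a => zmod_vars env a
  | 0 => env
  | _ => lazymatch zmod_mem env t with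
         | true => env
         | false => constr:(t :: env)
         end
  end.

Ltac zmod_idx env t :=
  lazymatch env with
  | t :: _ => constr:(0%N)
  | _ :: ?env' => let n := zmod_idx env' t in constr:(n.+1)
  end.

Ltac zmod_reify env t :=
  lazymatch t with
  | ?a + ?b => let ea := zmod_reify env a in
               let eb := zmod_reify env b in constr:(ZAdd ea eb)
  | - ?a => let ea := zmod_reify env a in constr:(ZOpp ea)
  | 0 => constr:(ZZero)
  | _ => let n := zmod_idx env t in constr:(ZVar n)
  end.

Ltac zmod :=
  lazymatch goal with
  | |- @eq ?T ?a ?b =>
    let env0 := zmod_vars (@nil T) a in
    let env := zmod_vars env0 b in
    let ea := zmod_reify env a in
    let eb := zmod_reify env b in
    change (zmod_eval env ea = zmod_eval env eb);
    apply: zmod_eval_eq; vm_compute; exact: erefl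
  end.

(** Transfers a known equation to a goal with the same formal difference of sides. In the additivity
    steps [c = d] is the sum of two known instances, and [zmod] proves the first premise. *)
Lemma zmod_eq_trans (M : zmodType) (a b c d : M) :
  a - b = c - d -> c = d -> a = b.
Proof. by move=> eq_d eq_cd; apply/subr0_eq; rewrite eq_d eq_cd subrr. Qed.

(** * Inverses, linearity and bijectivity read through injections and splittings *)

Lemma inverseK (K : fieldType) (U W : lmodType K) (f : U -> W) :
  injective f -> cancel f (inverse f).
Proof.
by move=> f_inj u; apply: pinvKV; [move=> v w _ _; apply: f_inj|apply: mem_set].
Qed.

Lemma inverse_bijK (K : fieldType) (U W : lmodType K) (f : U -> W) :
  bijective f -> cancel (inverse f) f.
Proof.
move=> f_bij w; case: (f_bij) => f' _ f'K.
by rewrite -(f'K w) inverseK //; apply: bij_inj.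
Qed.

(** The pseudo-inverses [inV0] and [inV1] come with no linearity of their own, so linearity of a map
    into V is tested after composing with the inclusion. *)
Lemma linear_of_inj (K : fieldType) (X U W : lmodType K) (i : {linear U -> W})
    (f : X -> W) (lam : X -> U) :
  injective i -> linear f -> (forall x, i (lam x) = f x) -> linear lam.
Proof.
by move=> i_inj lf lamE k x y; apply: i_inj; rewrite linearP !lamE lf.
Qed.

(** In the coordinates [(p, r)] the map [F] is block triangular with diagonal blocks [a] and [b], so
    back substitution inverts it. The abstract form serves both degrees. *)
Lemma split_bij (U W X : zmodType) (i : U -> W) (s : X -> W) (p : W -> X)
    (r : W -> U) (F : W -> W) (a : X -> X) (b : U -> U) (lam : X -> U) :
    (forall z, z = s (p z) + i (r z)) ->
    (forall x u, p (s x + i u) = x) -> (forall x u, r (s x + i u) = u) ->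
    (forall x u, F (s x + i u) = s (a x) + i (lam x + b u)) ->
  bijective a -> bijective b -> bijective F.
Proof.
move=> zE pE rE FE [a' aK a'K] [b' bK b'K].
exists (fun z => s (a' (p z)) + i (b' (r z - lam (a' (p z))))) => z.
  by rewrite (zE z) FE !pE !rE aK (addrC (lam _)) addrK bK.
by rewrite FE a'K b'K subrKC -zE.
Qed.

Section LinearMaps.
Variables (K : fieldType) (U U' W : lmodType K).

Definition mk_linear (f : U -> W) (lf : linear f) : {linear U -> W} :=
  HB.pack f (GRing.isLinear.Build _ _ _ _ f lf).

Definition mk_bilinear (f : U -> U' -> W) (bf : bilinear_for *:%R *:%R f) :
    {bilinear U -> U' -> W} :=
  HB.pack f (bilinear_isBilinear.Build _ _ _ _ _ _ f bf).

End LinearMaps.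

(** * Additivity of the operations and of homomorphisms *)

Section Leibniz2.
Variables (K : fieldType) (L : leibniz2 K).

Lemma l3Dl y z : {morph (fun x => l3 (l := L) x y z) : x x' / x + x'}.
Proof.
by case: (l3_trilinear L) => l _ _ x x'; have := l y z 1 x x'; rewrite !scale1r.
Qed.
Lemma l3Dm x z : {morph (fun y => l3 (l := L) x y z) : y y' / y + y'}.
Proof.
by case: (l3_trilinear L) => _ l _ y y'; have := l x z 1 y y'; rewrite !scale1r.
Qed.
Lemma l3Dr x y : {morph (fun z => l3 (l := L) x y z) : z z' / z + z'}.
Proof.
by case: (l3_trilinear L) => _ _ l z z'; have := l x y 1 z z'; rewrite !scale1r.
Qed.
Lemma l30l y z : l3 (l := L) 0 y z = 0.
Proof. by apply: (addIr (l3 0 y z)); rewrite add0r -l3Dl addr0. Qed.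
Lemma l30m x z : l3 (l := L) x 0 z = 0.
Proof. by apply: (addIr (l3 x 0 z)); rewrite add0r -l3Dm addr0. Qed.
Lemma l30r x y : l3 (l := L) x y 0 = 0.
Proof. by apply: (addIr (l3 x y 0)); rewrite add0r -l3Dr addr0. Qed.

End Leibniz2.

Section Additivity.
Variables (K : fieldType) (L M : leibniz2 K) (F : leibniz2_hom L M).

(* The generic [linearD] also matches [-%R] and [*:%R] and is too slow for the
   large sums below, hence these specialised copies. *)
Lemma diffD : {morph diff L : a b / a + b}. Proof. exact: linearD. Qed.
Lemma diffN : {morph diff L : a / - a}. Proof. exact: linearN. Qed.
Lemma hom0D : {morph hom0 F : x y / x + y}. Proof. exact: linearD. Qed.
Lemma hom0N : {morph hom0 F : x / - x}. Proof. exact: linearN. Qed.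
Lemma hom1D : {morph hom1 F : a b / a + b}. Proof. exact: linearD. Qed.
Lemma hom1N : {morph hom1 F : a / - a}. Proof. exact: linearN. Qed.
Lemma br00Dl x x' a : br00 L (x + x') a = br00 L x a + br00 L x' a.
Proof. exact: linearDl. Qed.
Lemma br00Dr x a a' : br00 L x (a + a') = br00 L x a + br00 L x a'.
Proof. exact: linearD. Qed.
Lemma br01Dl x x' a : br01 L (x + x') a = br01 L x a + br01 L x' a.
Proof. exact: linearDl. Qed.
Lemma br01Dr x a a' : br01 L x (a + a') = br01 L x a + br01 L x a'.
Proof. exact: linearD. Qed.
Lemma br10Dl x x' a : br10 L (x + x') a = br10 L x a + br10 L x' a.
Proof. exact: linearDl. Qed.
Lemma br10Dr x a a' : br10 L x (a + a') = br10 L x a + br10 L x a'.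
Proof. exact: linearD. Qed.

End Additivity.

Definition homE := (hom0D, hom1D, hom0N, hom1N).
Definition brE := (diffD, diffN, br00Dl, br00Dr, br01Dl, br01Dr, br10Dl, br10Dr,
  l3Dl, l3Dm, l3Dr).

Section StrictHom.
Variables (K : fieldType) (L M : leibniz2 K) (F : leibniz2_hom L M).
Hypothesis sF : strict F.

Lemma strict_br00 x y : hom0 F (br00 L x y) = br00 M (hom0 F x) (hom0 F y).
Proof. by apply/subr0_eq; rewrite hom_br00 sF linear0. Qed.

Lemma strict_br01 x a : hom1 F (br01 L x a) = br01 M (hom0 F x) (hom1 F a).
Proof. by apply/subr0_eq; rewrite hom_br01 sF. Qed.

Lemma strict_br10 a x : hom1 F (br10 L a x) = br10 M (hom1 F a) (hom0 F x).
Proof. by apply/subr0_eq; rewrite hom_br10 sF. Qed.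

Lemma strict_l3 x y z :
  hom1 F (l3 x y z) = l3 (hom0 F x) (hom0 F y) (hom0 F z).
Proof.
apply/subr0_eq; rewrite hom_l3 !sF !linear0 linear0l; zmod.
Qed.

End StrictHom.

(** * The operations of the extension in the decomposition s(g) + i(V) *)

Section Extension.
Variables (K : fieldType) (V g : leibniz2 K) (E : extension V g).
Variable s : splitting E.
Hypothesis abelE : abelian_extension E.

Local Notation h := (ghat E).
Local Notation i0 := (hom0 (inc E)).
Local Notation i1 := (hom1 (inc E)).
Local Notation p0 := (hom0 (proj E)).
Local Notation p1 := (hom1 (proj E)).
Local Notation s0 := (split0 s).
Local Notation s1 := (Defs.split1 s).

(** Off the image of [i0] the value of [inV0] is the default 0; exactness places the kernel of [p0]
    inside that image. *)
Lemma inV0K z : p0 z = 0 -> i0 (inV0 z) = z.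
Proof.
by move=> /exact0 [u _ <-]; rewrite /inV0 inverseK //; apply: inc0_inj.
Qed.

Lemma inV1K c : p1 c = 0 -> i1 (inV1 c) = c.
Proof.
by move=> /exact1 [u _ <-]; rewrite /inV1 inverseK //; apply: inc1_inj.
Qed.

Lemma p0i0 u : p0 (i0 u) = 0.
Proof. by apply/exact0; exists u. Qed.

Lemma p1i1 m : p1 (i1 m) = 0.
Proof. by apply/exact1; exists m. Qed.

Definition p0E := (strict_br00 (@proj_strict _ _ _ E), split0K, p0i0).
Definition p1E := (strict_br01 (@proj_strict _ _ _ E),
  strict_br10 (@proj_strict _ _ _ E), strict_l3 (@proj_strict _ _ _ E),
  split0K, split1K, p0i0, p1i1).

(* In the suffixes of the following names, [s] and [i] tell whether an argument
   lies in the image of the splitting or in V. *)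
Lemma br00_si x u : br00 h (s0 x) (i0 u) = i0 (rep_l00 s x u).
Proof. by rewrite inV0K // !p0E linear0. Qed.
Lemma br00_is u x : br00 h (i0 u) (s0 x) = i0 (rep_r00 s x u).
Proof. by rewrite inV0K // !p0E linear0l. Qed.
Lemma br01_si x m : br01 h (s0 x) (i1 m) = i1 (rep_l01 s x m).
Proof. by rewrite inV1K // !p1E linear0. Qed.
Lemma br10_is m x : br10 h (i1 m) (s0 x) = i1 (rep_r01 s x m).
Proof. by rewrite inV1K // !p1E linear0l. Qed.
Lemma br10_si a u : br10 h (s1 a) (i0 u) = i1 (rep_l1 s a u).
Proof. by rewrite inV1K // !p1E linear0. Qed.
Lemma br01_is u a : br01 h (i0 u) (s1 a) = i1 (rep_r1 s a u).
Proof. by rewrite inV1K // !p1E linear0l. Qed.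
(** The sign undoes the one in the definition of [rep_l2]; likewise for [rep_m2] and [rep_r2]
    below. *)
Lemma l3_ssi x y u : l3 (s0 x) (s0 y) (i0 u) = - i1 (rep_l2 s x y u).
Proof. by rewrite inV1K ?opprK // linearN !p1E l30r oppr0. Qed.
Lemma l3_sis x y u : l3 (s0 x) (i0 u) (s0 y) = - i1 (rep_m2 s x y u).
Proof. by rewrite inV1K ?opprK // linearN !p1E l30m oppr0. Qed.
Lemma l3_iss x y u : l3 (i0 u) (s0 x) (s0 y) = - i1 (rep_r2 s x y u).
Proof. by rewrite inV1K ?opprK // linearN !p1E l30l oppr0. Qed.
Lemma diff_s a : diff h (s1 a) = s0 (diff g a) + i0 (psi s a).
Proof. by rewrite inV0K ?subrKC // linearB hom_diff !p1E subrr. Qed.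
Lemma br00_ss x y : br00 h (s0 x) (s0 y) = s0 (br00 g x y) + i0 (omega s x y).
Proof. by rewrite inV0K ?subrKC // linearB !p0E subrr. Qed.
Lemma br01_ss x a : br01 h (s0 x) (s1 a) = s1 (br01 g x a) + i1 (mu s x a).
Proof. by rewrite inV1K ?subrKC // linearB !p1E subrr. Qed.
Lemma br10_ss a x : br10 h (s1 a) (s0 x) = s1 (br10 g a x) + i1 (nu s a x).
Proof. by rewrite inV1K ?subrKC // linearB !p1E subrr. Qed.
Lemma l3_sss x y z :
  l3 (s0 x) (s0 y) (s0 z) = s1 (l3 x y z) + i1 (theta s x y z).
Proof. by rewrite inV1K ?subrKC // linearB !p1E subrr. Qed.
Lemma diff_i m : diff h (i1 m) = i0 (diff V m).
Proof. by rewrite -hom_diff. Qed.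

Lemma br00_ii u v : br00 h (i0 u) (i0 v) = 0.
Proof.
case: abelE => -[ab _ _ _] _.
by rewrite -(strict_br00 (@inc_strict _ _ _ E)) ab linear0.
Qed.
Lemma br01_ii u m : br01 h (i0 u) (i1 m) = 0.
Proof.
case: abelE => -[_ ab _ _] _.
by rewrite -(strict_br01 (@inc_strict _ _ _ E)) ab linear0.
Qed.
Lemma br10_ii m u : br10 h (i1 m) (i0 u) = 0.
Proof.
case: abelE => -[_ _ ab _] _.
by rewrite -(strict_br10 (@inc_strict _ _ _ E)) ab linear0.
Qed.
(** The argument [z] ranges over all of ghat, so the ideal clause of [abelian_extension] is used;
    [abelian V] covers only arguments all in V. *)
Lemma l3_iiz u v z : l3 (i0 u) (i0 v) z = 0.
Proof. by case: abelE => _ /(_ u v z) []. Qed.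
Lemma l3_izi u v z : l3 (i0 u) z (i0 v) = 0.
Proof. by case: abelE => _ /(_ u v z) []. Qed.
Lemma l3_zii u v z : l3 z (i0 u) (i0 v) = 0.
Proof. by case: abelE => _ /(_ u v z) []. Qed.

(** A multiplication table: it turns operations on values of the splitting and of the inclusion into
    sums of such values. *)
Definition opE := (diff_s, br00_ss, br01_ss, br10_ss, l3_sss, diff_i,
  (br00_si, br00_is, br01_si, br10_is, br10_si, br01_is),
  (l3_ssi, l3_sis, l3_iss),
  (br00_ii, br01_ii, br10_ii, l3_iiz, l3_izi, l3_zii)).

(** * The V-coordinate z - s(p z), and induction over the two summands *)

Definition retr0 (z : g0 h) : g0 V := inV0 (z - s0 (p0 z)).
Definition retr1 (c : g1 h) : g1 V := inV1 (c - s1 (p1 c)).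

Lemma i0_retr0 z : i0 (retr0 z) = z - s0 (p0 z).
Proof. by rewrite inV0K // linearB split0K subrr. Qed.
Lemma i1_retr1 c : i1 (retr1 c) = c - s1 (p1 c).
Proof. by rewrite inV1K // linearB split1K subrr. Qed.
Lemma split0P z : z = s0 (p0 z) + i0 (retr0 z).
Proof. by rewrite i0_retr0 subrKC. Qed.
Lemma split1P c : c = s1 (p1 c) + i1 (retr1 c).
Proof. by rewrite i1_retr1 subrKC. Qed.
Lemma proj0D x u : p0 (s0 x + i0 u) = x.
Proof. by rewrite linearD split0K p0i0 addr0. Qed.
Lemma proj1D a m : p1 (s1 a + i1 m) = a.
Proof. by rewrite linearD split1K p1i1 addr0. Qed.
Lemma retr0D x u : retr0 (s0 x + i0 u) = u.
Proof. by apply: (@inc0_inj _ _ _ E); rewrite i0_retr0 proj0D addrC addKr. Qed.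
Lemma retr1D a m : retr1 (s1 a + i1 m) = m.
Proof. by apply: (@inc1_inj _ _ _ E); rewrite i1_retr1 proj1D addrC addKr. Qed.
Lemma retr0s x : retr0 (s0 x) = 0.
Proof.
by apply: (@inc0_inj _ _ _ E); rewrite i0_retr0 split0K subrr linear0.
Qed.
Lemma retr1s a : retr1 (s1 a) = 0.
Proof.
by apply: (@inc1_inj _ _ _ E); rewrite i1_retr1 split1K subrr linear0.
Qed.
Lemma retr0i u : retr0 (i0 u) = u.
Proof. by apply: (@inc0_inj _ _ _ E); rewrite i0_retr0 p0i0 linear0 subr0. Qed.
Lemma retr1i m : retr1 (i1 m) = m.
Proof. by apply: (@inc1_inj _ _ _ E); rewrite i1_retr1 p1i1 linear0 subr0. Qed.
Lemma retr0_linear : linear retr0.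
Proof.
apply: (linear_of_inj (@inc0_inj _ _ _ E) _ i0_retr0) => k z w.
by rewrite !linearP addrACA -scalerDr.
Qed.
Lemma retr1_linear : linear retr1.
Proof.
apply: (linear_of_inj (@inc1_inj _ _ _ E) _ i1_retr1) => k z w.
by rewrite !linearP addrACA -scalerDr.
Qed.

Lemma split0_ind (P : g0 h -> Prop) :
    (forall x, P (s0 x)) -> (forall u, P (i0 u)) ->
    (forall z w, P z -> P w -> P (z + w)) ->
  forall z, P z.
Proof. by move=> Ps Pi PD z; rewrite (split0P z); apply: PD. Qed.
Lemma split1_ind (P : g1 h -> Prop) :
    (forall a, P (s1 a)) -> (forall m, P (i1 m)) ->
    (forall c d, P c -> P d -> P (c + d)) ->
  forall c, P c.
Proof. by move=> Ps Pi PD c; rewrite (split1P c); apply: PD. Qed.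

(** [F0], [F1], [F2] are bare linear and bilinear maps: the predicate describes a given inducing
    homomorphism as well as a candidate whose axioms are still to be proved. *)
Definition components (beta : leibniz2_hom V V) (alpha : leibniz2_hom g g)
    (F0 : {linear g0 h -> g0 h}) (F1 : {linear g1 h -> g1 h})
    (F2 : {bilinear g0 h -> g0 h -> g1 h})
    (lam0 : {linear g0 g -> g0 V}) (lam1 : {linear g1 g -> g1 V})
    (lam2 : {bilinear g0 g -> g0 g -> g1 V}) : Prop :=
  [/\ forall x, F0 (s0 x) = s0 (hom0 alpha x) + i0 (lam0 x),
      forall u, F0 (i0 u) = i0 (hom0 beta u),
      forall a, F1 (s1 a) = s1 (hom1 alpha a) + i1 (lam1 a) &
      forall m, F1 (i1 m) = i1 (hom1 beta m)] /\
  [/\ forall x y, F2 (s0 x) (s0 y) = s1 (hom2 alpha x y) + i1 (lam2 x y),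
      forall u z, F2 (i0 u) z = 0 &
      forall z u, F2 z (i0 u) = 0].

(** * The homomorphism axioms on arguments from the two summands *)

Section Components.
Variables (beta : leibniz2_hom V V) (alpha : leibniz2_hom g g).
Variables (F0 : {linear g0 h -> g0 h}) (F1 : {linear g1 h -> g1 h}).
Variable F2 : {bilinear g0 h -> g0 h -> g1 h}.
Variables (lam0 : {linear g0 g -> g0 V}) (lam1 : {linear g1 g -> g1 V}).
Variable lam2 : {bilinear g0 g -> g0 g -> g1 V}.
Hypothesis compF : components beta alpha F0 F1 F2 lam0 lam1 lam2.
Local Notation a0 := (hom0 alpha).
Local Notation a1 := (hom1 alpha).
Local Notation a2 := (hom2 alpha).
Local Notation b0 := (hom0 beta).
Local Notation b1 := (hom1 beta).

Let F0s x : F0 (s0 x) = s0 (a0 x) + i0 (lam0 x).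
Proof. by case: compF => -[]. Qed.
Let F0i u : F0 (i0 u) = i0 (b0 u). Proof. by case: compF => -[]. Qed.
Let F1s a : F1 (s1 a) = s1 (a1 a) + i1 (lam1 a).
Proof. by case: compF => -[]. Qed.
Let F1i m : F1 (i1 m) = i1 (b1 m). Proof. by case: compF => -[]. Qed.
Let F2s x y : F2 (s0 x) (s0 y) = s1 (a2 x y) + i1 (lam2 x y).
Proof. by case: compF => _ []. Qed.
Let F2i u z : F2 (i0 u) z = 0. Proof. by case: compF => _ []. Qed.
Let F2r z u : F2 z (i0 u) = 0. Proof. by case: compF => _ []. Qed.
Let FE := (F0s, F0i, F1s, F1i, F2s, F2i, F2r).

(** Reduces each equivalence below, between an axiom in ghat and an equation in V, to one formal
    identity of differences, in which the s(g)-parts cancel. *)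
Lemma inc0_iff z w u v : z - w = i0 (u - v) -> z = w <-> u = v.
Proof.
move=> eq_zu; split=> [eq_zw|eq_uv]; apply/subr0_eq.
  by apply: (@inc0_inj _ _ _ E); rewrite -eq_zu eq_zw subrr linear0.
by rewrite eq_zu eq_uv subrr linear0.
Qed.
Lemma inc1_iff z w u v : z - w = i1 (u - v) -> z = w <-> u = v.
Proof.
move=> eq_zu; split=> [eq_zw|eq_uv]; apply/subr0_eq.
  by apply: (@inc1_inj _ _ _ E); rewrite -eq_zu eq_zw subrr linear0.
by rewrite eq_zu eq_uv subrr linear0.
Qed.

Let F0D : {morph F0 : z w / z + w}. Proof. exact: linearD. Qed.
Let F1D : {morph F1 : c d / c + d}. Proof. exact: linearD. Qed.
Let F1N : {morph F1 : c / - c}. Proof. exact: linearN. Qed.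
Let F2Dl z z' w : F2 (z + z') w = F2 z w + F2 z' w. Proof. exact: linearDl. Qed.
Let F2Dr z w w' : F2 z (w + w') = F2 z w + F2 z w'. Proof. exact: linearD. Qed.
Let FD := (F0D, F1D, F1N, F2Dl, F2Dr).
Let s0D : {morph s0 : x y / x + y}. Proof. exact: linearD. Qed.
Let s0N : {morph s0 : x / - x}. Proof. exact: linearN. Qed.
Let s1D : {morph s1 : a b / a + b}. Proof. exact: linearD. Qed.
Let s1N : {morph s1 : a / - a}. Proof. exact: linearN. Qed.
Let sE := (s0D, s1D, s0N, s1N).

(** The axioms of [alpha], here and in the next three facts, are solved for the image of an
    operation so that they can serve as rewrite rules. *)
Let a0_br00 x y : a0 (br00 g x y) = br00 g (a0 x) (a0 y) + diff g (a2 x y).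
Proof. by rewrite -hom_br00 subrKC. Qed.
Let a1_br01 x a : a1 (br01 g x a) = br01 g (a0 x) (a1 a) + a2 x (diff g a).
Proof. by rewrite -hom_br01 subrKC. Qed.
Let a1_br10 a x : a1 (br10 g a x) = br10 g (a1 a) (a0 x) + a2 (diff g a) x.
Proof. by rewrite -hom_br10 subrKC. Qed.
Let a1_l3 x y z : a1 (l3 x y z) = l3 (a0 x) (a0 y) (a0 z) +
    (a2 x (br00 g y z) - a2 (br00 g x y) z - a2 y (br00 g x z)
    + br01 g (a0 x) (a2 y z) - br10 g (a2 x y) (a0 z)
    - br01 g (a0 y) (a2 x z)).
Proof. by rewrite -hom_l3 subrKC. Qed.
Let aE := (hom_diff alpha, a0_br00, a1_br01, a1_br10, a1_l3).
(* [expE] rewrites every term as a sum of values of [s0], [s1], [i0], [i1]. *)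
Let expE := (FE, opE, FD, brE, homE, sE, aE).

(** The axioms of [leibniz2_hom] at fixed arguments, to be proved on the two summands first and then
    spread by additivity. *)
Definition hom_br00_at z1 z2 :=
  F0 (br00 h z1 z2) - br00 h (F0 z1) (F0 z2) = diff h (F2 z1 z2).
Definition hom_br01_at z c :=
  F1 (br01 h z c) - br01 h (F0 z) (F1 c) = F2 z (diff h c).
Definition hom_br10_at c z :=
  F1 (br10 h c z) - br10 h (F1 c) (F0 z) = F2 (diff h c) z.
Definition hom_l3_at z1 z2 z3 :=
  F1 (l3 z1 z2 z3) - l3 (F0 z1) (F0 z2) (F0 z3) =
    F2 z1 (br00 h z2 z3) - F2 (br00 h z1 z2) z3 - F2 z2 (br00 h z1 z3)
    + br01 h (F0 z1) (F2 z2 z3) - br10 h (F2 z1 z2) (F0 z3)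
    - br01 h (F0 z2) (F2 z1 z3).

Lemma hom_diff_s a :
  F0 (diff h (s1 a)) = diff h (F1 (s1 a)) <->
  b0 (psi s a) - psi s (a1 a) = diff V (lam1 a) - lam0 (diff g a).
Proof. apply: inc0_iff; rewrite !opE !FD !FE ?aE ?brE ?opE ?homE ?sE; zmod. Qed.

Lemma hom_diff_i m : F0 (diff h (i1 m)) = diff h (F1 (i1 m)).
Proof. by rewrite !expE hom_diff. Qed.

Lemma hom_br00_ss x y :
  hom_br00_at (s0 x) (s0 y) <->
  b0 (omega s x y) - omega s (a0 x) (a0 y)
  = rep_l00 s (a0 x) (lam0 y) + rep_r00 s (a0 y) (lam0 x)
    - lam0 (br00 g x y) + diff V (lam2 x y) + psi s (a2 x y).
Proof. apply: inc0_iff; rewrite !opE !FD !FE ?aE ?brE ?opE ?homE ?sE; zmod. Qed.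

Lemma hom_br01_ss x a :
  hom_br01_at (s0 x) (s1 a) <->
  b1 (mu s x a) - mu s (a0 x) (a1 a)
  = rep_l01 s (a0 x) (lam1 a) + rep_r1 s (a1 a) (lam0 x)
    - lam1 (br01 g x a) + lam2 x (diff g a).
Proof. apply: inc1_iff; rewrite !opE !FD !FE ?aE ?brE ?opE ?homE ?sE; zmod. Qed.

Lemma hom_br10_ss a x :
  hom_br10_at (s1 a) (s0 x) <->
  b1 (nu s a x) - nu s (a1 a) (a0 x)
  = rep_r01 s (a0 x) (lam1 a) + rep_l1 s (a1 a) (lam0 x)
    - lam1 (br10 g a x) + lam2 (diff g a) x.
Proof. apply: inc1_iff; rewrite !opE !FD !FE ?aE ?brE ?opE ?homE ?sE; zmod. Qed.

(** Expanded terms with two factors from the [lam] maps have two arguments in V and vanish, so the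
    equation has first degree in them. The terms in [mu] and [nu] come from brackets of split values
    of [a0] with split values of [a2]. *)
Lemma hom_l3_sss x y z :
  hom_l3_at (s0 x) (s0 y) (s0 z) <->
    b1 (theta s x y z)
      - theta s (a0 x) (a0 y) (a0 z)
      - mu s (a0 x) (a2 y z)
      + nu s (a2 x y) (a0 z)
      + rep_r1 s (a2 x z) (lam0 y)
      + mu s (a0 y) (a2 x z)
    = - rep_l2 s (a0 x) (a0 y) (lam0 z)
      - rep_m2 s (a0 x) (a0 z) (lam0 y)
      - lam1 (l3 x y z)
      - rep_r2 s (a0 y) (a0 z) (lam0 x)
      + lam2 x (br00 g y z) - lam2 (br00 g x y) z - lam2 y (br00 g x z)
      + rep_l01 s (a0 x) (lam2 y z)
      + rep_r1 s (a2 y z) (lam0 x)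
      - rep_r01 s (a0 z) (lam2 x y)
      - rep_l1 s (a2 x y) (lam0 z)
      - rep_l01 s (a0 y) (lam2 x z).
Proof. apply: inc1_iff; rewrite !opE !FD !FE ?aE ?brE ?opE ?homE ?sE; zmod. Qed.

(** An argument in V kills the [F2] side, and the [lam] part of the other argument brackets with V
    to zero; hence no [lam] or [a2] remains, here and in the next five lemmas. *)
Lemma hom_br00_si x u : hom_br00_at (s0 x) (i0 u) <->
  b0 (rep_l00 s x u) = rep_l00 s (a0 x) (b0 u).
Proof. apply: inc0_iff; rewrite !expE linear0; zmod. Qed.

Lemma hom_br00_is u x : hom_br00_at (i0 u) (s0 x) <->
  b0 (rep_r00 s x u) = rep_r00 s (a0 x) (b0 u).
Proof. apply: inc0_iff; rewrite !expE linear0; zmod. Qed.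

Lemma hom_br01_si x m : hom_br01_at (s0 x) (i1 m) <->
  b1 (rep_l01 s x m) = rep_l01 s (a0 x) (b1 m).
Proof. apply: inc1_iff; rewrite !expE; zmod. Qed.

Lemma hom_br01_is u a : hom_br01_at (i0 u) (s1 a) <->
  b1 (rep_r1 s a u) = rep_r1 s (a1 a) (b0 u).
Proof. apply: inc1_iff; rewrite !expE; zmod. Qed.

Lemma hom_br10_si a u : hom_br10_at (s1 a) (i0 u) <->
  b1 (rep_l1 s a u) = rep_l1 s (a1 a) (b0 u).
Proof. apply: inc1_iff; rewrite !expE; zmod. Qed.

Lemma hom_br10_is m x : hom_br10_at (i1 m) (s0 x) <->
  b1 (rep_r01 s x m) = rep_r01 s (a0 x) (b1 m).
Proof. apply: inc1_iff; rewrite !expE; zmod. Qed.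

(** Among the terms in [F2], only the bracket of [F2 (s0 x) (s0 y)] with [F0 (i0 u)] survives. Its
    side and sign in the axiom give [rep_l1] here, and [rep_r1] with opposite signs in the next two
    lemmas. *)
Lemma hom_l3_ssi x y u : hom_l3_at (s0 x) (s0 y) (i0 u) <->
  rep_l2 s (a0 x) (a0 y) (b0 u) + rep_l1 s (a2 x y) (b0 u)
  = b1 (rep_l2 s x y u).
Proof. apply: inc1_iff; rewrite !expE !linear0; zmod. Qed.

Lemma hom_l3_iss x y u : hom_l3_at (i0 u) (s0 x) (s0 y) <->
  rep_r2 s (a0 x) (a0 y) (b0 u) - rep_r1 s (a2 x y) (b0 u)
  = b1 (rep_r2 s x y u).
Proof. apply: inc1_iff; rewrite !expE !linear0 !linear0l; zmod. Qed.

Lemma hom_l3_sis x y u : hom_l3_at (s0 x) (i0 u) (s0 y) <->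
  rep_m2 s (a0 x) (a0 y) (b0 u) + rep_r1 s (a2 x y) (b0 u)
  = b1 (rep_m2 s x y u).
Proof. apply: inc1_iff; rewrite !expE !linear0 !linear0l; zmod. Qed.

(** * Extension of the axioms from the two summands to all arguments *)

Lemma hom_diff_all :
  (forall a, F0 (diff h (s1 a)) = diff h (F1 (s1 a))) ->
  forall c, F0 (diff h c) = diff h (F1 c).
Proof.
move=> hs; elim/split1_ind => [//|m|c d eq_c eq_d]; first exact: hom_diff_i.
by rewrite !expE eq_c eq_d.
Qed.

Lemma hom_br00_all :
  (forall x y, hom_br00_at (s0 x) (s0 y)) ->
  (forall x u, hom_br00_at (s0 x) (i0 u)) ->
  (forall u x, hom_br00_at (i0 u) (s0 x)) ->
  forall z w, hom_br00_at z w.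
Proof.
move=> hss hsi his z w; elim/split0_ind: z w => [x w|u w|z z' hz hz' w].
- elim/split0_ind: w => // w w' hw hw'; rewrite /hom_br00_at !(FD, brE).
  by apply: (zmod_eq_trans _ (congr2 +%R hw hw')); zmod.
- elim/split0_ind: w => // [v|w w' hw hw'].
    (* Both arguments lie in V, and every term vanishes. *)
    by rewrite /hom_br00_at !expE !linear0; zmod.
  rewrite /hom_br00_at !(FD, brE).
  by apply: (zmod_eq_trans _ (congr2 +%R hw hw')); zmod.
- rewrite /hom_br00_at !(FD, brE).
  by apply: (zmod_eq_trans _ (congr2 +%R (hz w) (hz' w))); zmod.
Qed.

Lemma hom_br01_all :
  (forall x a, hom_br01_at (s0 x) (s1 a)) ->
  (forall x m, hom_br01_at (s0 x) (i1 m)) ->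
  (forall u a, hom_br01_at (i0 u) (s1 a)) ->
  forall z c, hom_br01_at z c.
Proof.
move=> hss hsi his z c; elim/split0_ind: z c => [x c|u c|z z' hz hz' c].
- elim/split1_ind: c => // c c' hc hc'; rewrite /hom_br01_at !(FD, brE).
  by apply: (zmod_eq_trans _ (congr2 +%R hc hc')); zmod.
- elim/split1_ind: c => // [v|c c' hc hc'].
    by rewrite /hom_br01_at !expE !linear0; zmod.
  rewrite /hom_br01_at !(FD, brE).
  by apply: (zmod_eq_trans _ (congr2 +%R hc hc')); zmod.
- rewrite /hom_br01_at !(FD, brE).
  by apply: (zmod_eq_trans _ (congr2 +%R (hz c) (hz' c))); zmod.
Qed.

Lemma hom_br10_all :
  (forall a x, hom_br10_at (s1 a) (s0 x)) ->
  (forall a u, hom_br10_at (s1 a) (i0 u)) ->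
  (forall m x, hom_br10_at (i1 m) (s0 x)) ->
  forall c z, hom_br10_at c z.
Proof.
move=> hss hsi his c z; elim/split1_ind: c z => [a z|m z|c c' hc hc' z].
- elim/split0_ind: z => // z z' hz hz'; rewrite /hom_br10_at !(FD, brE).
  by apply: (zmod_eq_trans _ (congr2 +%R hz hz')); zmod.
- elim/split0_ind: z => // [v|z z' hz hz'].
    by rewrite /hom_br10_at !expE !linear0; zmod.
  rewrite /hom_br10_at !(FD, brE).
  by apply: (zmod_eq_trans _ (congr2 +%R hz hz')); zmod.
- rewrite /hom_br10_at !(FD, brE).
  by apply: (zmod_eq_trans _ (congr2 +%R (hc z) (hc' z))); zmod.
Qed.

Lemma hom_l3_Dl z z' w t :
  hom_l3_at z w t -> hom_l3_at z' w t -> hom_l3_at (z + z') w t.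
Proof.
move=> hz hz'; rewrite /hom_l3_at !(FD, brE).
by apply: (zmod_eq_trans _ (congr2 +%R hz hz')); zmod.
Qed.
Lemma hom_l3_Dm z w w' t :
  hom_l3_at z w t -> hom_l3_at z w' t -> hom_l3_at z (w + w') t.
Proof.
move=> hw hw'; rewrite /hom_l3_at !(FD, brE).
by apply: (zmod_eq_trans _ (congr2 +%R hw hw')); zmod.
Qed.
Lemma hom_l3_Dr z w t t' :
  hom_l3_at z w t -> hom_l3_at z w t' -> hom_l3_at z w (t + t').
Proof.
move=> ht ht'; rewrite /hom_l3_at !(FD, brE).
by apply: (zmod_eq_trans _ (congr2 +%R ht ht')); zmod.
Qed.

(** Any two of the three arguments include one in V, so the inner values of [F2] vanish. Each outer
    one has an argument in V or a bracket of two elements of V, which is zero, and the [l3] terms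
    vanish by the ideal clause. *)
Lemma hom_l3_ii u v z : [/\ hom_l3_at (i0 u) (i0 v) z,
  hom_l3_at (i0 u) z (i0 v) & hom_l3_at z (i0 u) (i0 v)].
Proof.
split; elim/split0_ind: z => [x|w|z z' hz hz'];
  try (by rewrite /hom_l3_at !(FE, opE) !linear0 !linear0l; zmod);
  by [apply: hom_l3_Dl|apply: hom_l3_Dm|apply: hom_l3_Dr].
Qed.

Lemma hom_l3_all :
  (forall x y z, hom_l3_at (s0 x) (s0 y) (s0 z)) ->
  (forall x y u, hom_l3_at (s0 x) (s0 y) (i0 u)) ->
  (forall x y u, hom_l3_at (s0 x) (i0 u) (s0 y)) ->
  (forall x y u, hom_l3_at (i0 u) (s0 x) (s0 y)) ->
  forall z w t, hom_l3_at z w t.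
Proof.
move=> hsss hssi hsis hiss z w t.
elim/split0_ind: z => [x|u|z z' hz hz']; last exact: hom_l3_Dl.
  elim/split0_ind: w => [y|v|w w' hw hw']; last exact: hom_l3_Dm.
    by elim/split0_ind: t => // t t'; apply: hom_l3_Dr.
  elim/split0_ind: t => [//|v'|t t']; last exact: hom_l3_Dr.
  by case: (hom_l3_ii v v' (s0 x)).
elim/split0_ind: w => [y|v|w w' hw hw']; last exact: hom_l3_Dm.
  elim/split0_ind: t => [//|v'|t t']; last exact: hom_l3_Dr.
  by case: (hom_l3_ii u v' (s0 y)).
by case: (hom_l3_ii u v t).
Qed.

End Components.

(** * Inducibility in terms of components *)

Section Inducible.
Variables (beta : leibniz2_hom V V) (alpha : leibniz2_hom g g).
Hypothesis beta_aut : automorphism beta.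
Hypothesis alpha_aut : automorphism alpha.

Local Notation a0 := (hom0 alpha).
Local Notation a1 := (hom1 alpha).
Local Notation a2 := (hom2 alpha).
Local Notation b0 := (hom0 beta).
Local Notation b1 := (hom1 beta).

(** From left to right, lambda is the deviation of F s from s alpha, which the projection kills.
    Conversely, bijectivity follows from the triangular shape, and F(V) = V from surjectivity of
    [beta]. *)
Lemma inducibleP : inducible s beta alpha <->
  exists (F : leibniz2_hom h h) lam0 lam1 lam2,
    components beta alpha (hom0 F) (hom1 F) (hom2 F) lam0 lam1 lam2.
Proof.
split=> [[F [_ _ [F0i pF0] [F1i pF1] [F2i pF2]]]|[F [l0 [l1 [l2]]]]].
  pose f0 x := hom0 F (s0 x) - s0 (a0 x).
  pose f1 a := hom1 F (s1 a) - s1 (a1 a).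
  pose f2 x y := hom2 F (s0 x) (s0 y) - s1 (a2 x y).
  have i0f0 x : i0 (inV0 (f0 x)) = f0 x.
    by rewrite inV0K // linearB pF0 split0K subrr.
  have i1f1 a : i1 (inV1 (f1 a)) = f1 a.
    by rewrite inV1K // linearB pF1 split1K subrr.
  have i1f2 x y : i1 (inV1 (f2 x y)) = f2 x y.
    by rewrite inV1K // linearB pF2 split1K subrr.
  have lf0 : linear (fun x => inV0 (f0 x)).
    apply: (linear_of_inj (@inc0_inj _ _ _ E) _ i0f0) => k x y.
    by rewrite /f0 !linearP addrACA -scalerDr.
  have lf1 : linear (fun x => inV1 (f1 x)).
    apply: (linear_of_inj (@inc1_inj _ _ _ E) _ i1f1) => k x y.
    by rewrite /f1 !linearP addrACA -scalerDr.
  have lf2 : bilinear_for *:%R *:%R (fun x y => inV1 (f2 x y)).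
    split=> [y|x].
      apply: (linear_of_inj (@inc1_inj _ _ _ E) _ (i1f2^~ y)) => k x x'.
      by rewrite /f2 linearP !linearPl linearP scalerBr opprD addrACA.
    apply: (linear_of_inj (@inc1_inj _ _ _ E) _ (i1f2 x)) => k y y'.
    by rewrite /f2 !linearP addrACA -scalerDr.
  exists F, (mk_linear lf0), (mk_linear lf1), (mk_bilinear lf2).
  split; first by split=> // [x|a] /=; rewrite ?i0f0 ?i1f1 subrKC.
  split=> [x y|u z|z u]; [|by case: (F2i u z)..].
  by rewrite /= i1f2 subrKC.
case=> -[F0s F0i F1s F1i] [F2s F2i F2r]; exists F.
have [[a0_bij a1_bij] [b0_bij b1_bij]] := (alpha_aut, beta_aut).
split.
- split; [apply: (split_bij split0P proj0D retr0D _ a0_bij b0_bij)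
         |apply: (split_bij split1P proj1D retr1D _ a1_bij b1_bij)] => x u.
    by rewrite linearD F0s F0i linearD addrA.
  by rewrite linearD F1s F1i linearD addrA.
- split; apply/seteqP; split=> [_ [_ [u _ <-] <-]|_ [u _ <-]].
  + by rewrite F0i; exists (b0 u).
  + have [b' _ b'K] := b0_bij; exists (i0 (b' u)); first by exists (b' u).
    by rewrite F0i b'K.
  + by rewrite F1i; exists (b1 u).
  + have [b' _ b'K] := b1_bij; exists (i1 (b' u)); first by exists (b' u).
    by rewrite F1i b'K.
- by split=> // x; rewrite F0s proj0D.
- by split=> // a; rewrite F1s proj1D.
- by split=> // x y; rewrite F2s proj1D.
Qed.

(** * The candidate automorphism built from lambda *)

Section Assembly.
Variables (lam0 : {linear g0 g -> g0 V}) (lam1 : {linear g1 g -> g1 V}).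
Variable lam2 : {bilinear g0 g -> g0 g -> g1 V}.

(** The formula is forced by the decomposition of [z]. Below, [map2] has no retraction term because
    F_2 must vanish as soon as one argument lies in V. *)
Definition map0 z := s0 (a0 (p0 z)) + i0 (lam0 (p0 z) + b0 (retr0 z)).
Definition map1 c := s1 (a1 (p1 c)) + i1 (lam1 (p1 c) + b1 (retr1 c)).
Definition map2 z w :=
  s1 (a2 (p0 z) (p0 w)) + i1 (lam2 (p0 z) (p0 w)).

Lemma map0_linear : linear map0.
Proof.
move=> k z w; rewrite /map0 retr0_linear !linearP scalerDr [RHS]addrACA.
by rewrite -[X in _ = _ + X]linearP scalerDr addrACA.
Qed.
Lemma map1_linear : linear map1.
Proof.
move=> k z w; rewrite /map1 retr1_linear !linearP scalerDr [RHS]addrACA.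
by rewrite -[X in _ = _ + X]linearP scalerDr addrACA.
Qed.
Lemma map2_bilinear : bilinear_for *:%R *:%R map2.
Proof.
split=> [w|w] k z z'; rewrite /map2 linearP ?linearPl !linearP.
  by rewrite /= scalerDr [RHS]addrACA.
by rewrite /= scalerDr [RHS]addrACA.
Qed.

Lemma map_components : components beta alpha (mk_linear map0_linear)
  (mk_linear map1_linear) (mk_bilinear map2_bilinear) lam0 lam1 lam2.
Proof.
split; [split=> [x|u|a|m]|split=> [x y|u z|z u]] => /=.
- by rewrite /map0 split0K retr0s linear0 addr0.
- by rewrite /map0 p0i0 retr0i !linear0 !add0r.
- by rewrite /map1 split1K retr1s linear0 addr0.
- by rewrite /map1 p1i1 retr1i !linear0 !add0r.
- by rewrite /map2 !split0K.
- by rewrite /map2 p0i0 !linear0l !linear0 addr0.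
- by rewrite /map2 p0i0 !linear0 addr0.
Qed.

End Assembly.
End Inducible.
End Extension.

(** * Inducibility as solvability of the cocycle and representation equations *)

Theorem theorem3p2 (K : fieldType) (V g : leibniz2 K) (E : extension V g)
    (abelE : abelian_extension E) (s : splitting E)
    (beta : leibniz2_hom V V) (beta_aut : automorphism beta)
    (beta_strict : strict beta)
    (alpha : leibniz2_hom g g) (alpha_aut : automorphism alpha) :
  inducible s beta alpha <->
  exists (lam0 : {linear g0 g -> g0 V}) (lam1 : {linear g1 g -> g1 V})
         (lam2 : {bilinear g0 g -> g0 g -> g1 V}),
  forall (x y z : g0 g) (a : g1 g) (v w : g0 V) (m : g1 V),
    hom0 beta (psi s a) - psi s (hom1 alpha a)
    = diff V (lam1 a) - lam0 (diff g a)
  /\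
    hom0 beta (omega s x y) - omega s (hom0 alpha x) (hom0 alpha y)
    = rep_l00 s (hom0 alpha x) (lam0 y) + rep_r00 s (hom0 alpha y) (lam0 x)
      - lam0 (br00 g x y) + diff V (lam2 x y) + psi s (hom2 alpha x y)
  /\
    hom1 beta (mu s x a) - mu s (hom0 alpha x) (hom1 alpha a)
    = rep_l01 s (hom0 alpha x) (lam1 a) + rep_r1 s (hom1 alpha a) (lam0 x)
      - lam1 (br01 g x a) + lam2 x (diff g a)
  /\
    hom1 beta (nu s a x) - nu s (hom1 alpha a) (hom0 alpha x)
    = rep_r01 s (hom0 alpha x) (lam1 a) + rep_l1 s (hom1 alpha a) (lam0 x)
      - lam1 (br10 g a x) + lam2 (diff g a) x
  /\
    hom1 beta (theta s x y z)
      - theta s (hom0 alpha x) (hom0 alpha y) (hom0 alpha z)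
      - mu s (hom0 alpha x) (hom2 alpha y z)
      + nu s (hom2 alpha x y) (hom0 alpha z)
      + rep_r1 s (hom2 alpha x z) (lam0 y)
      + mu s (hom0 alpha y) (hom2 alpha x z)
    = - rep_l2 s (hom0 alpha x) (hom0 alpha y) (lam0 z)
      - rep_m2 s (hom0 alpha x) (hom0 alpha z) (lam0 y)
      - lam1 (l3 x y z)
      - rep_r2 s (hom0 alpha y) (hom0 alpha z) (lam0 x)
      + lam2 x (br00 g y z) - lam2 (br00 g x y) z - lam2 y (br00 g x z)
      + rep_l01 s (hom0 alpha x) (lam2 y z)
      + rep_r1 s (hom2 alpha y z) (lam0 x)
      - rep_r01 s (hom0 alpha z) (lam2 x y)
      - rep_l1 s (hom2 alpha x y) (lam0 z)
      - rep_l01 s (hom0 alpha y) (lam2 x z)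
  /\
    hom0 beta (rep_l00 s x (inverse (hom0 beta) v))
    = rep_l00 s (hom0 alpha x) v
  /\
    hom0 beta (rep_r00 s x (inverse (hom0 beta) v))
    = rep_r00 s (hom0 alpha x) v
  /\
    hom1 beta (rep_l01 s x (inverse (hom1 beta) m))
    = rep_l01 s (hom0 alpha x) m
  /\
    hom1 beta (rep_r01 s x (inverse (hom1 beta) m))
    = rep_r01 s (hom0 alpha x) m
  /\
    hom1 beta (rep_r1 s a (inverse (hom0 beta) v))
    = rep_r1 s (hom1 alpha a) v
  /\
    hom1 beta (rep_l1 s a (inverse (hom0 beta) v))
    = rep_l1 s (hom1 alpha a) v
  /\
    rep_l2 s (hom0 alpha x) (hom0 alpha y) w + rep_l1 s (hom2 alpha x y) w
    = hom1 beta (rep_l2 s x y (inverse (hom0 beta) w))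
  /\
    rep_r2 s (hom0 alpha x) (hom0 alpha y) w - rep_r1 s (hom2 alpha x y) w
    = hom1 beta (rep_r2 s x y (inverse (hom0 beta) w))
  /\
    rep_m2 s (hom0 alpha x) (hom0 alpha y) w + rep_r1 s (hom2 alpha x y) w
    = hom1 beta (rep_m2 s x y (inverse (hom0 beta) w)).
Proof.
have [b0_bij b1_bij] := beta_aut.
have [b0_inj b1_inj] := (bij_inj b0_bij, bij_inj b1_bij).
rewrite (inducibleP s beta_aut alpha_aut).
split=> [[F [lam0 [lam1 [lam2 compF]]]]|[lam0 [lam1 [lam2 eqs]]]].
  exists lam0, lam1, lam2 => x y z a v w m.
  (* Writing [v], [w], [m] as images under [beta] turns the conjugation equations into the
     intertwining form of the component lemmas. *)
  rewrite -(inverse_bijK b0_bij v) -(inverse_bijK b0_bij w).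
  rewrite -(inverse_bijK b1_bij m) !(inverseK b0_inj) !(inverseK b1_inj).
  split; first by apply/(hom_diff_s compF); apply: hom_diff.
  split; first by apply/(hom_br00_ss abelE compF); apply: hom_br00.
  split; first by apply/(hom_br01_ss abelE compF); apply: hom_br01.
  split; first by apply/(hom_br10_ss abelE compF); apply: hom_br10.
  split; first by apply/(hom_l3_sss abelE compF); apply: hom_l3.
  split; first by apply/(hom_br00_si abelE compF); apply: hom_br00.
  split; first by apply/(hom_br00_is abelE compF); apply: hom_br00.
  split; first by apply/(hom_br01_si abelE compF); apply: hom_br01.
  split; first by apply/(hom_br10_is abelE compF); apply: hom_br10.
  split; first by apply/(hom_br01_is abelE compF); apply: hom_br01.
  split; first by apply/(hom_br10_si abelE compF); apply: hom_br10.
  split; first by apply/(hom_l3_ssi abelE compF); apply: hom_l3.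
  split; first by apply/(hom_l3_iss abelE compF); apply: hom_l3.
  by apply/(hom_l3_sis abelE compF); apply: hom_l3.
(* Conversely, evaluating at images under [beta] lets the inverses cancel. *)
have {}eqs x y z a v w m :=
  eqs x y z a (hom0 beta v) (hom0 beta w) (hom1 beta m).
pose F0 := mk_linear (map0_linear s beta alpha lam0).
pose F1 := mk_linear (map1_linear s beta alpha lam1).
pose F2 := mk_bilinear (map2_bilinear s alpha lam2).
have compF : components s beta alpha F0 F1 F2 lam0 lam1 lam2.
  exact: map_components.
(* The equations are quantified jointly; here and below, variables absent from the extracted
   conjunct are set to 0. *)
have hd := hom_diff_all compF
  (fun a => (hom_diff_s compF a).2 (proj1 (eqs 0 0 0 a 0 0 0))).
have h00 : forall z w, hom_br00_at F0 F2 z w.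
  apply: (hom_br00_all abelE compF) => [x y|x u|u x].
  - apply/(hom_br00_ss abelE compF).
    by have [_ [e _]] := eqs x y 0 0 0 0 0.
  - apply/(hom_br00_si abelE compF).
    by have [_ [_ [_ [_ [_ [e _]]]]]] := eqs x 0 0 0 u 0 0;
      rewrite (inverseK b0_inj) in e.
  - apply/(hom_br00_is abelE compF).
    by have [_ [_ [_ [_ [_ [_ [e _]]]]]]] := eqs x 0 0 0 u 0 0;
      rewrite (inverseK b0_inj) in e.
have h01 : forall z c, hom_br01_at F0 F1 F2 z c.
  apply: (hom_br01_all abelE compF) => [x a|x m|u a].
  - apply/(hom_br01_ss abelE compF).
    by have [_ [_ [e _]]] := eqs x 0 0 a 0 0 0.
  - apply/(hom_br01_si abelE compF).
    by have [_ [_ [_ [_ [_ [_ [_ [e _]]]]]]]] := eqs x 0 0 0 0 0 m;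
      rewrite (inverseK b1_inj) in e.
  - apply/(hom_br01_is abelE compF).
    by have [_ [_ [_ [_ [_ [_ [_ [_ [_ [e _]]]]]]]]]] := eqs 0 0 0 a u 0 0;
      rewrite (inverseK b0_inj) in e.
have h10 : forall c z, hom_br10_at F0 F1 F2 c z.
  apply: (hom_br10_all abelE compF) => [a x|a u|m x].
  - apply/(hom_br10_ss abelE compF).
    by have [_ [_ [_ [e _]]]] := eqs x 0 0 a 0 0 0.
  - apply/(hom_br10_si abelE compF).
    by have [_ [_ [_ [_ [_ [_ [_ [_ [_ [_ [e _]]]]]]]]]]] := eqs 0 0 0 a u 0 0;
      rewrite (inverseK b0_inj) in e.
  - apply/(hom_br10_is abelE compF).
    by have [_ [_ [_ [_ [_ [_ [_ [_ [e _]]]]]]]]] := eqs x 0 0 0 0 0 m;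
      rewrite (inverseK b1_inj) in e.
have hl3 : forall z w t, hom_l3_at F0 F1 F2 z w t.
  apply: (hom_l3_all abelE compF) => [x y z|x y u|x y u|x y u].
  - apply/(hom_l3_sss abelE compF).
    by have [_ [_ [_ [_ [e _]]]]] := eqs x y z 0 0 0 0.
  - apply/(hom_l3_ssi abelE compF).
    by have [_ [_ [_ [_ [_ [_ [_ [_ [_ [_ [_ [e _]]]]]]]]]]]] :=
      eqs x y 0 0 0 u 0;
      rewrite (inverseK b0_inj) in e.
  - apply/(hom_l3_sis abelE compF).
    by have [_ [_ [_ [_ [_ [_ [_ [_ [_ [_ [_ [_ [_ e]]]]]]]]]]]]] :=
      eqs x y 0 0 0 u 0;
      rewrite (inverseK b0_inj) in e.
  - apply/(hom_l3_iss abelE compF).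
    by have [_ [_ [_ [_ [_ [_ [_ [_ [_ [_ [_ [_ [e _]]]]]]]]]]]]] :=
      eqs x y 0 0 0 u 0;
      rewrite (inverseK b0_inj) in e.
by exists (Leibniz2Hom hd h00 h01 h10 hl3), lam0, lam1, lam2.
Qed.
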